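(* Let $F\subset\mathbb{R}^d$. Then, for any $\theta\in(0,1)$, we have $$\overline{\dim}_{A}^\theta F=d\quad\text{if and only if}\quad \dim_{A}^\theta F=d,$$ and $$\overline{\dim}_{A}^\theta F=0\quad\text{if and only if}\quad \dim_{A}^\theta F=0.$$
   Context: For a nonempty bounded set $E\subset\mathbb{R}^d$ and $\delta>0$, $N_\delta(E)$ denotes the smallest number of closed balls of radius $\delta$ needed to cover $E$. $B(x,R)=\{y\in\mathbb{R}^d:\|y-x\|\le R\}$ is the closed Euclidean ball. For $\theta\in(0,1)$ and $F\subset\mathbb{R}^d$ (bounded or not), the Assouad spectrum is $\dim_A^\theta F:=\inf\{s\ge 0:$ there exists a constant $C>0$ such that for all $0<r=R^{1/\theta}<R<1$ and all $x\in F$, $N_r(B(x,R)\cap F)\le C(R/r)^s\}$, and the upper spectrum is $\overline{\dim}_A^\theta F:=\inf\{s\ge 0:$ there exists a constant $C>0$ such that for all $0<r\le R^{1/\theta}<R<1$ and all $x\in F$, $N_r(B(x,R)\cap F)\le C(R/r)^s\}$. Both are $0$ for $F=\emptyset$. *)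

(* Defs.v *)
From HB Require Import structures.
From mathcomp Require Import all_boot all_order all_algebra.
From mathcomp Require Import all_classical all_reals all_analysis.
Set Implicit Arguments.
Unset Strict Implicit.
Unset Printing Implicit Defensive.
Import Order.TTheory GRing.Theory Num.Theory.
Local Open Scope classical_set_scope.
Local Open Scope ring_scope.

(* The library norm on 'rV[R]_d is the sup norm, so the Euclidean one is
   defined here. *)
Definition enorm (R : realType) (d : nat) (x : 'rV[R]_d) : R :=
  Num.sqrt (\sum_(i < d) x ord0 i ^+ 2).

Definition cball (R : realType) (d : nat) (x : 'rV[R]_d) (rho : R) :
    set 'rV[R]_d :=
  [set y | enorm (y - x) <= rho].

Definition covered_by_balls (R : realType) (d : nat) (E : set 'rV[R]_d)
    (delta : R) (n : nat) : Prop :=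
  exists c : 'I_n -> 'rV[R]_d, E `<=` \bigcup_i cball (c i) delta.

(* As an infimum in \bar R of a set of natural numbers, this is the minimum of
   that set, or +oo if E has no finite cover by balls of radius delta (which
   does not happen for E bounded and delta > 0). *)
Definition covering_number (R : realType) (d : nat) (E : set 'rV[R]_d)
    (delta : R) : \bar R :=
  ereal_inf [set (n%:R)%:E | n in [set n | covered_by_balls E delta n]].

Definition assouad_spectrum (R : realType) (d : nat) (theta : R)
    (F : set 'rV[R]_d) : \bar R :=
  ereal_inf [set s%:E | s in [set s : R | 0 <= s /\
    exists2 C : R, 0 < C &
      forall r rho : R, 0 < r -> r = rho `^ theta^-1 ->
        rho `^ theta^-1 < rho -> rho < 1 ->
      forall x : 'rV[R]_d, F x ->
        (covering_number (cball x rho `&` F) r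
           <= (C * (rho / r) `^ s)%:E)%E]].

Definition upper_spectrum (R : realType) (d : nat) (theta : R)
    (F : set 'rV[R]_d) : \bar R :=
  ereal_inf [set s%:E | s in [set s : R | 0 <= s /\
    exists2 C : R, 0 < C &
      forall r rho : R, 0 < r -> r <= rho `^ theta^-1 ->
        rho `^ theta^-1 < rho -> rho < 1 ->
      forall x : 'rV[R]_d, F x ->
        (covering_number (cball x rho `&` F) r
           <= (C * (rho / r) `^ s)%:E)%E]].

(* Main.v *)
Require Import Defs.
From HB Require Import structures.
From mathcomp Require Import all_boot all_order all_algebra.
From mathcomp Require Import all_classical all_reals all_analysis.
From mathcomp Require Import ring lra.
Import Order.TTheory GRing.Theory Num.Theory.
Local Open Scope classical_set_scope.
Local Open Scope ring_scope.

(** Write N_r for the covering number at scale r, t for the exponent theta,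
    and B(x, rho) for the closed Euclidean ball.

    Two inequalities are immediate: the upper spectrum dominates the Assouad
    spectrum ([assouad_le_upper]), and it is at most the dimension d, because a
    grid covers B(x, rho) by O((rho / r)^d) balls of radius r
    ([covered_cball], [upper_spectrum_le_dim]).  Together with nonnegativity
    they reduce the theorem to two implications: a spectrum smaller than d
    forces an upper spectrum smaller than d, and a zero spectrum forces a zero
    upper spectrum.

    Both rest on refining a cover ([covered_refine]): if each ball of radius rho
    centred in F meets F in a set covered by at most m balls of radius r,
    then N_r(E) <= H m N_rho(E) for E included in F, where H depends on d only.
    This is used with rho = r^t, the one scale at which an exponent s of the
    Assouad spectrum gives m <= C (r^t / r)^s.

    For dimension d, one refinement is enough.  Covering B(x, rho) by the grid
    down to scale r^t <= rho, then using s from r^t to r, gives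
    N_r <= K (rho / r^t)^d (r^t / r)^s.  As rho < 1 we have
    rho / r^t <= (rho / r)^t, so the exponent t d + (1 - t) s < d is admissible
    for the upper spectrum ([upper_spectrum_lt_dim]).

    For dimension 0, the refinement is iterated on the unit ball.  If s < e, the
    claim N_r(B(x, 1) meet F) <= A r^(-e) passes from r^t to r as soon as
    H C r^((1 - t)(e - s)) <= 1, that is for all r below some threshold r0;
    above r0 the grid bound serves.  No constant accumulates along the iteration
    ([spectrum_exponent_cover]).  When r <= rho^(1/t) we have
    rho / r >= r^(t - 1), so A r^(-e) <= A (rho / r)^(e / (1 - t)), and
    e / (1 - t) can be made arbitrarily small ([upper_spectrum_le_of_small]). *)

(** * Covers by balls *)

Lemma covering_number_le (R : realType) (d : nat) (E : set 'rV[R]_d)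
    (delta a : R) (n : nat) :
  covered_by_balls E delta n -> n%:R <= a ->
  (covering_number E delta <= a%:E)%E.
Proof.
move=> En na; apply: ge_ereal_inf; exists (n%:R)%:E; last by rewrite lee_fin.
by exists n.
Qed.

Lemma covered_of_covering_number_le (R : realType) (d : nat)
    (E : set 'rV[R]_d) (delta a : R) :
  0 <= a -> (covering_number E delta <= a%:E)%E ->
  exists2 n, covered_by_balls E delta n & n%:R <= a.
Proof.
move=> a0 Ea; have /andP[ta at1] := truncn_itv a0.
have /ereal_inf_lt[_ [n En <-]] :
  (covering_number E delta < ((Num.truncn a).+1%:R)%:E)%E.
  by apply: le_lt_trans Ea _; rewrite lte_fin.
rewrite lte_fin ltr_nat ltnS => nt.
by exists n => //; apply: le_trans ta; rewrite ler_nat.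
Qed.

Lemma covered_card (R : realType) (d : nat) (E : set 'rV[R]_d) (delta : R)
    (T : finType) (c : T -> 'rV[R]_d) :
  (forall y, E y -> exists i, cball (c i) delta y) ->
  covered_by_balls E delta #|T|.
Proof.
move=> Ec; exists (fun i => c (enum_val i)) => y /Ec[i iy].
by exists (enum_rank i) => //; rewrite enum_rankK.
Qed.

Lemma sub_covered (R : realType) (d : nat) (E E' : set 'rV[R]_d) (delta : R)
    (n : nat) :
  E `<=` E' -> covered_by_balls E' delta n -> covered_by_balls E delta n.
Proof. by move=> EE' [c cE']; exists c; apply: subset_trans cE'. Qed.

Lemma leq_covered (R : realType) (d : nat) (E : set 'rV[R]_d) (delta : R)
    (m n : nat) :
  (m <= n)%N -> covered_by_balls E delta m -> covered_by_balls E delta n.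
Proof.
move=> mn [c cE].
exists (fun i : 'I_n => oapp c 0 (insub (i : nat))) => y /cE[i _ iy].
exists (widen_ord mn i) => //=.
by rewrite insubT //= => im; rewrite (_ : Sub _ _ = i) //; apply: val_inj.
Qed.

(** Refining a cover multiplies the numbers of balls. *)
Lemma covered_mul (R : realType) (d : nat) (E : set 'rV[R]_d)
    (delta delta' : R) (m n : nat) :
  covered_by_balls E delta n ->
  (forall c, covered_by_balls (cball c delta `&` E) delta' m) ->
  covered_by_balls E delta' (n * m).
Proof.
move=> [c cE] /choice[b bE].
have -> : (n * m)%N = #|{: 'I_n * 'I_m}| by rewrite card_prod !card_ord.
apply: (@covered_card _ _ _ _ _ (fun p => b (c p.1) p.2)) => y Ey.
have [i _ iy] := cE y Ey; have [j _ jy] := bE (c i) y (conj iy Ey).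
by exists (i, j).
Qed.

Lemma enorm_le_coord (R : realType) (d : nat) (v : 'rV[R]_d) (i : 'I_d) :
  `|v ord0 i| <= enorm v.
Proof.
rewrite -sqrtr_sqr /enorm ler_sqrt ?sumr_ge0// => [|j _]; last exact: sqr_ge0.
by rewrite (bigD1 i)//= lerDl sumr_ge0// => j _; apply: sqr_ge0.
Qed.

Lemma enorm_le_coords (R : realType) (d : nat) (v : 'rV[R]_d) (a : R) :
  0 <= a -> (forall i, `|v ord0 i| <= a / d.+1%:R) -> enorm v <= a.
Proof.
move=> a0 va; rewrite -(ger0_norm a0) -sqrtr_sqr ler_wsqrtr//.
apply: (@le_trans _ _ (\sum_(i < d) (a / d.+1%:R) ^+ 2)).
  apply: ler_sum => i _; rewrite -real_normK ?num_real//.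
  by rewrite lerXn2r ?nnegrE ?divr_ge0 ?ler0n ?normr_ge0.
rewrite sumr_const card_ord -[leLHS]mulr_natl expr_div_n mulrA ler_pdivrMr; last first.
  by rewrite exprn_gt0 ?ltr0n.
rewrite mulrC ler_wpM2l ?sqr_ge0// expr2 -natrM ler_nat.
by rewrite (leq_trans (leqnSn d))// leq_pmulr.
Qed.

(** The inequality |p + q|^2 <= 2 |p|^2 + 2 |q|^2 suffices here; the full
    triangle inequality is not needed. *)
Lemma enorm_sub_le (R : realType) (d : nat) (a : R) (u v w : 'rV[R]_d) :
  0 <= a -> enorm (u - w) <= a / 2 -> enorm (v - w) <= a / 2 ->
  enorm (u - v) <= a.
Proof.
move=> a0 uw vw.
have sq (t : 'rV[R]_d) b : 0 <= b -> (enorm t <= b) =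
     (\sum_(i < d) t ord0 i ^+ 2 <= b ^+ 2).
  move=> b0; rewrite -{1}(ger0_norm b0) -sqrtr_sqr /enorm ler_sqrt//.
  exact: sqr_ge0.
have a20 : 0 <= a / 2 by rewrite divr_ge0.
move: uw vw; rewrite !sq// => uw vw.
apply: (@le_trans _ _ (2 * (\sum_(i < d) (u - w) ord0 i ^+ 2) +
                       2 * (\sum_(i < d) (v - w) ord0 i ^+ 2))).
  rewrite -mulrDr -big_split mulr_sumr; apply: ler_sum => i _ /=.
  rewrite !mxE -subr_ge0.
  have := sqr_ge0 (u ord0 i + v ord0 i - w ord0 i *+ 2); congr (_ <= _).
  by ring.
by move: uw vw; rewrite !expr_div_n => uw vw; lra.
Qed.

(** A ball of radius [rho] is covered by balls of radius [r] centred at the nodes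
    of a grid of mesh [r / (d + 1)]: points whose coordinates differ by at most
    the mesh are at Euclidean distance at most [r]. *)
Lemma covered_cball (R : realType) (d : nat) (x : 'rV[R]_d) (r rho : R) :
  0 < r -> r <= rho ->
  exists2 n, covered_by_balls (cball x rho) r n &
    n%:R <= ((2 * d + 3)%:R * (rho / r)) ^+ d.
Proof.
move=> r0 rrho; have rho0 : 0 < rho by exact: lt_le_trans rrho.
have d0 : (0 : R) < d.+1%:R by rewrite ltr0n.
set h := r / d.+1%:R; have h0 : 0 < h by rewrite divr_gt0.
set N := (Num.truncn (2 * rho / h)).+1.
have hN : 0 <= 2 * rho / h by rewrite divr_ge0 ?mulr_ge0 ?ltW.
(* A grid point is indexed by the number of mesh steps, in each coordinate, from
   the corner x - rho of the cube circumscribed to the ball. *)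
exists #|{: {ffun 'I_d -> 'I_N}}|.
  apply: (@covered_card R d (cball x rho) r {ffun 'I_d -> 'I_N}
    (fun k => \row_i (x ord0 i - rho + h * (k i)%:R))) => y xy.
  have yb i : `|y ord0 i - x ord0 i| <= rho.
    have := enorm_le_coord _ _ (y - x) i; rewrite !mxE => /le_trans; exact.
  have k0 i : 0 <= (y ord0 i - x ord0 i + rho) / h.
    by have := yb i; rewrite ler_norml => /andP[? ?]; rewrite divr_ge0 ?(ltW h0)//; lra.
  have kN i : (Num.truncn ((y ord0 i - x ord0 i + rho) / h) < N)%N.
    rewrite ltnS le_truncn// ler_pM2r ?invr_gt0//.
    by have := yb i; rewrite ler_norml => /andP[? ?]; lra.
  exists [ffun i => Ordinal (kN i)].
  apply: enorm_le_coords => [|i]; first exact: ltW.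
  rewrite !mxE ffunE /= -/h.
  have /andP[] := truncn_itv (k0 i).
  set t := Num.truncn _; rewrite ler_pdivlMr// ltr_pdivrMr// -natr1 => t1 t2.
  by rewrite ler_norml; apply/andP; split; nra.
rewrite card_ffun !card_ord natrX lerXn2r ?nnegrE ?ler0n//.
  by rewrite mulr_ge0 ?ler0n ?divr_ge0 ?ltW.
rewrite /N -natr1; have := truncn_le (2 * rho / h); rewrite hN => tN.
have r1 : 1 <= rho / r by rewrite ler_pdivlMr ?mul1r.
have E : 2 * rho / h = 2 * d.+1%:R * (rho / r).
  by rewrite /h; field; rewrite ?lt0r_neq0//= ?nat1r ?lt0r_neq0.
have : (2 * d + 3)%:R = 2 * d.+1%:R + 1 :> R.
  by rewrite -natr1 natrD natrM; ring.
move=> ->; rewrite [leRHS]mulrDl mul1r -E.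
by apply: lerD.
Qed.

(** A bound on the number of balls of half the radius that cover a ball; it is
    the bound of [covered_cball] for the ratio 2. *)
Definition halving_const (R : realType) (d : nat) : R :=
  ((2 * d + 3)%:R * 2) ^+ d.

(** The covering hypothesis on [F] concerns only balls centred in [F], while the
    centres of a cover of [E] are arbitrary.  Passing to radius [rho / 2]
    remedies this: a ball of radius [rho / 2] that meets [E] at [y] traces on [E]
    a subset of the ball of radius [rho] centred at [y]. *)
Lemma covered_refine (R : realType) (d : nat) (F E : set 'rV[R]_d)
    (r rho a : R) (n : nat) :
  0 < rho -> 0 <= a -> E `<=` F -> covered_by_balls E rho n ->
  (forall y, F y -> exists2 m,
    covered_by_balls (cball y rho `&` F) r m & m%:R <= a) ->
  exists2 k, covered_by_balls E r k & k%:R <= n%:R * (halving_const R d * a).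
Proof.
move=> rho0 a0 EF En Fa.
pose K := Num.truncn (halving_const R d); pose m := Num.truncn a.
have h0 : 0 <= halving_const R d.
  by rewrite exprn_ge0 ?mulr_ge0 ?ler0n.
have half c : covered_by_balls (cball c rho `&` E) (rho / 2) K.
  have [||l cl lK] := covered_cball _ _ c (rho / 2) rho; [lra|lra|].
  apply: sub_covered (leq_covered _ _ _ _ _ _ _ cl) => [y []//|].
  rewrite truncn_ge_nat// (le_trans lK)//.
  by rewrite invf_div [rho * _]mulrC mulfVK ?lt0r_neq0.
have small c : covered_by_balls (cball c (rho / 2) `&` E) r m.
  have [[y [yc yE]]|/set0P/negP/negPn/eqP ->] :=
      pselect (cball c (rho / 2) `&` E !=set0); last first.
    by apply: (@leq_covered _ _ _ _ 0) => //; exists (fun=> 0).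
  have [l yl la] := Fa y (EF _ yE).
  apply: sub_covered (leq_covered _ _ _ _ _ _ _ yl); last by rewrite truncn_ge_nat.
  move=> z [zc zE]; split; last exact: EF.
  exact: (enorm_sub_le _ _ _ _ _ c (ltW rho0)).
exists (n * K * m)%N; first exact: covered_mul (covered_mul _ _ _ _ _ _ _ En half) small.
rewrite -mulnA natrM ler_wpM2l ?ler0n// natrM.
by rewrite ler_pM ?ler0n// truncn_le.
Qed.

(** * Exponents of the two spectra *)

Lemma powR_lt1 (R : realType) (r t : R) :
  0 < r -> r < 1 -> 0 < t -> r `^ t < 1.
Proof.
move=> r0 r1 t0.
have <- : 1 `^ t = 1 :> R by rewrite powR1.
by rewrite gt0_ltr_powR// nnegrE ltW.
Qed.

Lemma powR_gt (R : realType) (r t : R) :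
  0 < r -> r < 1 -> t < 1 -> r < r `^ t.
Proof.
move=> r0 r1 t1; rewrite -{1}(powRr1 (ltW r0)) -{1}(subrK t 1) powRD; last first.
  by rewrite lt0r_neq0// implybT.
by rewrite gtr_pMl ?powR_gt0// powR_lt1// subr_gt0.
Qed.

(** [s] is an admissible exponent in the infimum defining the Assouad spectrum.
    The condition is parametrized by the small radius [r], the large one being
    [r `^ theta], and covering numbers are replaced by actual covers. *)
Definition spectrum_exponent (R : realType) (d : nat) (theta : R)
    (F : set 'rV[R]_d) (s : R) : Prop :=
  0 <= s /\ exists2 C : R, 0 < C &
    forall r : R, 0 < r -> r < 1 -> forall x, F x -> exists2 n,
      covered_by_balls (cball x (r `^ theta) `&` F) r n &
      n%:R <= C * (r `^ theta / r) `^ s.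

Lemma assouad_spectrum_lt (R : realType) (d : nat) (theta : R)
    (F : set 'rV[R]_d) (a : R) :
  0 < theta -> theta < 1 -> (assouad_spectrum theta F < a%:E)%E ->
  exists2 s, s < a & spectrum_exponent R d theta F s.
Proof.
move=> theta0 theta1 /ereal_inf_lt[_ [s [s0 [C C0 CF]] <-]].
rewrite lte_fin => sa; exists s => //; split=> //; exists C => // r r0 r1 x Fx.
have rE : (r `^ theta) `^ theta^-1 = r.
  by rewrite -powRrM divff ?powRr1 ?ltW// lt0r_neq0.
apply: covered_of_covering_number_le.
  by rewrite mulr_ge0 ?powR_ge0 ?(ltW C0).
apply: CF => //; rewrite ?rE//.
  exact: powR_gt.
exact: powR_lt1.
Qed.

(** The constraint [r <= rho `^ theta^-1] is used in the form
    [r `^ theta <= rho]; the inequality [r <= r `^ theta] comes from [r < 1]. *)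
Lemma upper_spectrum_le (R : realType) (d : nat) (theta : R)
    (F : set 'rV[R]_d) (s C : R) :
  0 < theta -> theta < 1 -> 0 <= s -> 0 < C ->
  (forall r rho : R, 0 < r -> r <= r `^ theta -> r `^ theta <= rho -> rho < 1 ->
    forall x, F x -> exists2 n,
      covered_by_balls (cball x rho `&` F) r n & n%:R <= C * (rho / r) `^ s) ->
  (upper_spectrum theta F <= s%:E)%E.
Proof.
move=> theta0 theta1 s0 C0 CF; apply: ge_ereal_inf; exists s%:E => //.
exists s => //; split=> //; exists C => // r rho r0 rrho rho_lt rho1 x Fx.
have rho0 : 0 < rho by apply: le_lt_trans rho_lt; exact: powR_ge0.
have [||||n En nC] := CF r rho _ _ _ _ x Fx => //; last first.
  exact: covering_number_le En nC.
- have -> : rho = (rho `^ theta^-1) `^ theta.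
    by rewrite -powRrM mulVf ?powRr1 ?ltW// lt0r_neq0.
  by apply: ge0_ler_powR; rewrite ?nnegrE ?powR_ge0// ltW.
- by apply: ger1_powR; rewrite ?r0 ?ltW//= (le_lt_trans rrho)// (lt_trans rho_lt).
Qed.

Lemma assouad_le_upper (R : realType) (d : nat) (theta : R)
    (F : set 'rV[R]_d) :
  (assouad_spectrum theta F <= upper_spectrum theta F)%E.
Proof.
apply: ereal_inf_le_tmp => _ [s [s0 [C C0 CF]] <-].
exists s => //; split=> //; exists C => // r rho r0 rE.
by apply: CF => //; rewrite rE.
Qed.

Lemma assouad_spectrum_ge0 (R : realType) (d : nat) (theta : R)
    (F : set 'rV[R]_d) : (0 <= assouad_spectrum theta F)%E.
Proof. by apply: le_ereal_inf_tmp => _ [s [s0 _] <-]; rewrite lee_fin. Qed.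

Lemma ratio_ge1 (R : realType) (r rho : R) : 0 < r -> r <= rho -> 1 <= rho / r.
Proof. by move=> r0 rrho; rewrite ler_pdivlMr ?mul1r. Qed.

Lemma upper_spectrum_le_dim (R : realType) (d : nat) (theta : R)
    (F : set 'rV[R]_d) :
  0 < theta -> theta < 1 -> (upper_spectrum theta F <= (d%:R)%:E)%E.
Proof.
move=> theta0 theta1.
apply: (@upper_spectrum_le _ _ _ _ _ ((2 * d + 3)%:R ^+ d)) => //.
move=> r rho r0 r1 r2 rho1 x Fx; have rrho := le_trans r1 r2.
have [n nc nK] := covered_cball R d x r rho r0 rrho.
exists n; first by apply: sub_covered nc => y [].
by rewrite powR_mulrn -?exprMn// (le_trans ler01)// ratio_ge1.
Qed.

(** * Spectrum smaller than the dimension *)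

Lemma upper_spectrum_lt_dim (R : realType) (d : nat) (theta s : R)
    (F : set 'rV[R]_d) :
  0 < theta -> theta < 1 -> s <= d%:R -> spectrum_exponent R d theta F s ->
  (upper_spectrum theta F <= (theta * d%:R + (1 - theta) * s)%:E)%E.
Proof.
move=> theta0 theta1 sd [s0 [C C0 CF]].
pose K : R := (2 * d + 3)%:R ^+ d; pose H := halving_const R d.
have K0 : 0 < K by rewrite /K exprn_gt0// ltr0n addn3.
have H0 : 0 < H by rewrite /H /halving_const exprn_gt0// mulr_gt0// ltr0n addn3.
apply: (@upper_spectrum_le _ _ _ _ _ (K * H * C)) => //.
- by rewrite addr_ge0// mulr_ge0 ?subr_ge0// ltW.
- by rewrite !mulr_gt0.
move=> r rho r0 r1 r2 rho1 x Fx; have rrho := le_trans r1 r2.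
set t := r `^ theta in r1 r2.
have t0 : 0 < t by exact: powR_gt0.
have rho0 : 0 < rho by exact: lt_le_trans r2.
have [n nc nK] := covered_cball R d x t rho t0 r2.
have [//|||||k kc kn] :=
  covered_refine R d F (cball x rho `&` F) r t (C * (t / r) `^ s) n.
- by rewrite mulr_ge0 ?powR_ge0// ltW.
- by move=> y [].
- by apply: sub_covered nc => y [].
- by apply: CF => //; rewrite (le_lt_trans rrho).
exists k => //; apply: (le_trans kn); rewrite exprMn -/K -powR_mulrn in nK; last first.
  by rewrite divr_ge0 ?ltW.
apply: (@le_trans _ _ (K * (rho / t) `^ d%:R * (H * (C * (t / r) `^ s)))).
  by apply: ler_wpM2r nK; rewrite !mulr_ge0 ?powR_ge0// ltW.
have -> : K * (rho / t) `^ d%:R * (H * (C * (t / r) `^ s)) =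
  K * H * C * ((rho / t) `^ d%:R * (t / r) `^ s) by ring.
rewrite ler_wpM2l//; first by rewrite ltW ?mulr_gt0.
have rt0 : 0 < rho / t by rewrite divr_gt0.
have rr0 : 0 < rho / r by rewrite divr_gt0.
(* As d - s >= 0, it remains to bound rho / t by a power of rho / r. *)
have -> : (rho / t) `^ d%:R * (t / r) `^ s =
          (rho / t) `^ (d%:R - s) * (rho / r) `^ s.
  have -> : rho / r = (rho / t) * (t / r) by field; rewrite !lt0r_neq0.
  rewrite (@powRM _ (rho / t) (t / r) s) ?divr_ge0 ?ltW// mulrA -powRD ?subrK//.
  by rewrite lt0r_neq0// implybT.
have -> : theta * d%:R + (1 - theta) * s = theta * (d%:R - s) + s by ring.
rewrite [leRHS]powRD; last by rewrite lt0r_neq0// implybT.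
rewrite ler_wpM2r ?powR_ge0// powRrM.
apply: ge0_ler_powR; rewrite ?subr_ge0 ?nnegrE ?powR_ge0 ?(ltW rt0)//.
rewrite powRM ?invr_ge0 ?(ltW r0) ?(ltW rho0)// -(powR_inv1 (ltW r0)) powRAC powR_inv1 ?powR_ge0//.
rewrite -/t ler_wpM2r ?invr_ge0 ?(ltW t0)//.
(* rho <= rho^theta because rho < 1. *)
by apply: ger1_powR; rewrite ?rho0 ?ltW.
Qed.

(** * Spectrum equal to zero *)

(** Iterating [r |-> r `^ theta] from any [r] in (0, 1) exceeds [r0] after
    finitely many steps: below [r0], each step decreases [- ln r] by at least
    [(1 - theta) * - ln r0]. *)
Lemma powR_theta_ind (R : realType) (theta r0 : R) (P : R -> Prop) :
  0 < theta -> theta < 1 -> 0 < r0 -> r0 < 1 ->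
  (forall r, r0 <= r -> r < 1 -> P r) ->
  (forall r, 0 < r -> r < r0 -> P (r `^ theta) -> P r) ->
  forall r, 0 < r -> r < 1 -> P r.
Proof.
move=> theta0 theta1 r00 r01 base step.
have lr0 : 0 < - ln r0 by rewrite oppr_gt0 ln_lt0// r00.
pose delta := (1 - theta) * - ln r0.
have delta0 : 0 < delta by rewrite mulr_gt0 ?subr_gt0.
suff main n r : 0 < r -> r < 1 -> - ln r <= n%:R * delta -> P r.
  move=> r rgt0 rlt1; apply: (main (Num.truncn (- ln r / delta)).+1) => //.
  rewrite -ler_pdivrMr//; apply/ltW.
  have /truncn_itv/andP[] : 0 <= - ln r / delta; last by [].
  by rewrite divr_ge0 ?(ltW delta0)// oppr_ge0 ln_le0// ltW.
elim: n r => [|n IH] r rgt0 rlt1.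
  by rewrite mul0r oppr_le0 leNgt ln_lt0// rgt0.
move=> rn; have [r0r|rr0] := leP r0 r; first exact: base.
apply: step => //; apply: IH; first exact: powR_gt0.
  exact: powR_lt1.
rewrite ln_powR; move: rn; rewrite -natr1 mulrDl mul1r {2}/delta.
have : ln r <= ln r0 by rewrite ler_ln ?posrE// ltW.
by nra.
Qed.

(** Unlike the hypothesis on [s], which ties the two radii together, the
    conclusion bounds covers of a ball of fixed radius at every small scale. *)
Lemma spectrum_exponent_cover (R : realType) (d : nat) (theta s e : R)
    (F : set 'rV[R]_d) :
  0 < theta -> theta < 1 -> s < e -> spectrum_exponent R d theta F s ->
  exists2 A : R, 0 < A & forall r : R, 0 < r -> r < 1 -> forall x : 'rV[R]_d,
    exists2 n, covered_by_balls (cball x 1 `&` F) r n & n%:R <= A * r `^ (- e).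
Proof.
move=> theta0 theta1 se [s0 [C C0 CF]].
pose H := halving_const R d.
have H0 : 0 < H by rewrite /H /halving_const exprn_gt0// mulr_gt0// ltr0n addn3.
pose B := H * C + 1; have B1 : 1 < B by rewrite ltrDr mulr_gt0.
have B0 : 0 < B by exact: lt_trans B1.
pose q := (1 - theta) * (e - s).
have q0 : 0 < q by rewrite mulr_gt0// subr_gt0.
(* The threshold below which one refinement costs nothing: r0^q = 1 / B. *)
pose r0 := B^-1 `^ q^-1.
have r00 : 0 < r0 by rewrite powR_gt0// invr_gt0.
have r01 : r0 < 1 by rewrite powR_lt1 ?invr_gt0// invf_lt1.
have r0q : r0 `^ q = B^-1.
  by rewrite -powRrM mulVf ?lt0r_neq0// powRr1// invr_ge0 ltW.
pose A : R := ((2 * d + 3)%:R * (1 / r0)) ^+ d.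
have A0 : 0 < A by rewrite exprn_gt0// mulr_gt0 ?divr_gt0// ltr0n addn3.
exists A => // r rgt0 rlt1 x; move: r rgt0 rlt1.
apply: (powR_theta_ind _ theta r0) => // r.
  move=> r0r r1; have rgt0 : 0 < r by exact: lt_le_trans r0r.
  have [n nc nK] := covered_cball R d x r 1 rgt0 (ltW r1).
  exists n; first by apply: sub_covered nc => y [].
  apply: (le_trans nK); apply: (@le_trans _ _ A).
    rewrite lerXn2r ?nnegrE ?mulr_ge0 ?ler0n ?ler01 ?invr_ge0 ?(ltW rgt0)
      ?(ltW r00)//.
    by rewrite ler_wpM2l ?ler0n// !mul1r lef_pV2 ?posrE.
  rewrite ler_peMr ?(ltW A0)// powRN invf_ge1 ?powR_gt0// ltW// powR_lt1//.
  exact: le_lt_trans se.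
move=> rgt0 rr0 [n nc nA]; have r1 : r < 1 by exact: lt_trans r01.
have t0 : 0 < r `^ theta by exact: powR_gt0.
have [//|||||k kc kn] := covered_refine R d F (cball x 1 `&` F) r (r `^ theta)
  (C * (r `^ theta / r) `^ s) n.
- by rewrite mulr_ge0 ?powR_ge0 ?(ltW C0).
- by move=> y [].
- exact: nc.
- exact: CF.
exists k => //; apply: (le_trans kn).
apply: (le_trans (ler_wpM2r _ nA)).
  by rewrite !mulr_ge0 ?powR_ge0 ?(ltW C0) ?(ltW H0).
have rn0 : r != 0 by rewrite lt0r_neq0.
have -> : r `^ theta / r = r `^ (theta - 1).
  by rewrite powRB ?powRr1 ?(ltW rgt0)// rn0 implybT.
rewrite -!powRrM.
have -> : A * r `^ (theta * - e) *
    (halving_const R d * (C * r `^ ((theta - 1) * s)))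
  = A * (H * C * (r `^ (theta * - e) * r `^ ((theta - 1) * s))).
  by rewrite /H; ring.
rewrite ler_wpM2l ?(ltW A0)// -powRD ?rn0 ?implybT//.
have -> : theta * - e + (theta - 1) * s = - e + q by rewrite /q; ring.
rewrite powRD ?rn0 ?implybT// mulrCA ler_piMr ?powR_ge0//.
apply: (@le_trans _ _ (B * r0 `^ q)); last by rewrite r0q divff ?lt0r_neq0.
rewrite ler_pM ?powR_ge0 ?mulr_ge0 ?(ltW H0) ?(ltW C0)//.
  by rewrite /B lerDl.
by apply: ge0_ler_powR; rewrite ?nnegrE ?ltW.
Qed.

Lemma upper_spectrum_le_of_small (R : realType) (d : nat) (theta s t : R)
    (F : set 'rV[R]_d) :
  0 < theta -> theta < 1 -> s < (1 - theta) * t ->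
  spectrum_exponent R d theta F s -> (upper_spectrum theta F <= t%:E)%E.
Proof.
move=> theta0 theta1 st sF.
have [A A0 AF] := spectrum_exponent_cover _ _ _ _ _ _ theta0 theta1 st sF.
have t0 : 0 <= t.
  have := le_lt_trans sF.1 st; rewrite pmulr_rgt0 ?subr_gt0//; exact: ltW.
apply: (@upper_spectrum_le _ _ _ _ _ A) => // r rho r0 r1 r2 rho1 x Fx.
have [n nc nA] := AF r r0 (le_lt_trans (le_trans r1 r2) rho1) x.
exists n.
  by apply: sub_covered nc => y [xy Fy]; split=> //; exact: le_trans xy (ltW rho1).
apply: (le_trans nA); rewrite ler_wpM2l ?(ltW A0)// -mulNr powRrM.
have rn0 : r != 0 by rewrite lt0r_neq0.
apply: ge0_ler_powR; rewrite ?nnegrE ?powR_ge0//.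
  by rewrite divr_ge0 ?(ltW r0)// (le_trans _ r2)// powR_ge0.
rewrite opprB powRB ?rn0 ?implybT// powRr1 ?(ltW r0)//.
by rewrite ler_wpM2r ?invr_ge0 ?(ltW r0).
Qed.

(** * The extreme values of the two spectra *)

Theorem theorem3p9 (R : realType) (d : nat) (F : set 'rV[R]_d) (theta : R)
    (theta_gt0 : 0 < theta) (theta_lt1 : theta < 1) :
  (upper_spectrum theta F = (d%:R)%:E <-> assouad_spectrum theta F = (d%:R)%:E)
  /\
  (upper_spectrum theta F = 0%E <-> assouad_spectrum theta F = 0%E).
Proof.
have le_au := assouad_le_upper R d theta F.
have le_ud := upper_spectrum_le_dim R d theta F theta_gt0 theta_lt1.
split; split=> [uE|aE].
- apply/eqP; rewrite eq_le -{1}uE le_au /= leNgt; apply/negP.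
  move=> /(assouad_spectrum_lt _ _ _ _ _ theta_gt0 theta_lt1)[s sd sF].
  have := upper_spectrum_lt_dim R d theta s F theta_gt0 theta_lt1 (ltW sd) sF.
  rewrite uE lee_fin; apply/negP; rewrite -ltNge -subr_gt0.
  have -> : d%:R - (theta * d%:R + (1 - theta) * s)
          = (1 - theta) * (d%:R - s) by ring.
  by rewrite mulr_gt0// subr_gt0.
- by apply/eqP; rewrite eq_le le_ud -aE le_au.
- by apply/eqP; rewrite eq_le assouad_spectrum_ge0 andbT -uE.
- apply/eqP; rewrite eq_le -{2}aE le_au andbT.
  apply/lee_addgt0Pr => t t0; rewrite add0e.
  have [s st sF] : exists2 s, s < (1 - theta) * t &
      spectrum_exponent R d theta F s.
    by apply: assouad_spectrum_lt => //; rewrite aE lte_fin mulr_gt0 ?subr_gt0.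
  exact: upper_spectrum_le_of_small st sF.
Qed.
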